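(* Let $N\in\mathbb{N}$ and let $\beta_k\in\mathbb{R}\cup\{\infty\}$ for each $k\ge 0$. Let $(\eta^N_n)_{n=1}^N$ be the $\{0,1\}^N$-valued random variable with law \[\mathbf{P}\left((\eta^N_n)_{n=1}^{N}=x\right)=\frac{1}{Z}\exp\left(-\sum_{k=0}^\infty\beta_kf_k(x)\right)\mathbf{1}_{\{f_0(x)<N/2\}},\qquad x\in\{0,1\}^N,\] where $Z$ is the normalising constant and the functions $f_k$ are as defined in the context, and extend it to an $N$-periodic random configuration $\eta^N=(\eta^N_n)_{n\in\mathbb{Z}}$ by cyclic repetition. Let $W^N$ be the carrier process of $\eta^N$. Then \[\overleftarrow{\eta}^N\stackrel{d}{=}\eta^N,\qquad \bar{W}^N\stackrel{d}{=}W^N,\qquad T\eta^N\stackrel{d}{=}\eta^N.\] In particular, $\eta^N$ is invariant in distribution under $T$.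
   Context: Box-ball system. For a configuration $\eta=(\eta_n)_{n\in\mathbb{Z}}\in\{0,1\}^{\mathbb{Z}}$, the path encoding $S:\mathbb{Z}\to\mathbb{Z}$ is given by $S_0=0$ and $S_n-S_{n-1}=1-2\eta_n$ for all $n\in\mathbb{Z}$. Let $M_n=\sup_{m\le n}S_m$ (past maximum). If $M_0<\infty$, set $(TS)_n=2M_n-S_n-2M_0$ and let $T\eta\in\{0,1\}^{\mathbb{Z}}$ be given by $(T\eta)_n=\mathbf{1}_{\{(TS)_n-(TS)_{n-1}=-1\}}$. The carrier process is $W_n=M_n-S_n$. The reversed configuration is $\overleftarrow{\eta}_n=\eta_{-(n-1)}$ and the reversed carrier process is $\bar W_n=W_{-n}$, $n\in\mathbb{Z}$. (If an $N$-periodic configuration has fewer than $N/2$ particles per period, then $M_0<\infty$.) Functions $f_k:\{0,1\}^N\to\mathbb{Z}_+$. $f_0(x)=\sum_{n=1}^N x_n$. For a finite string $x=(x_n)_{n=1}^m$ of $0$s and $1$s, put $x_0:=x_m$ and $f_1(x)=\sum_{n=1}^m\mathbf{1}_{\{x_{n-1}=1,\,x_n=0\}}$ (equal to $0$ for the empty string). $H(x)$ is the finite string obtained from $x$ by (simultaneously) removing all adjacent pairs $(x_{n-1},x_n)=(1,0)$, including the pair $(x_m,x_1)$ if it equals $(1,0)$, and keeping the remaining entries in order. For $k\ge2$, $f_k(x)=f_1(H^{k-1}(x))$. Convention: if $\beta_k=\infty$ and $f_k(x)=0$ then $\beta_kf_k(x)=0$; also $\exp(-\infty)=0$. *)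

(* Defs.v *)
From HB Require Import structures.
From mathcomp Require Import all_boot all_order all_algebra.
From mathcomp Require Import all_classical all_reals all_analysis.

Set Implicit Arguments.
Unset Strict Implicit.
Unset Printing Implicit Defensive.

Import Order.TTheory GRing.Theory Num.Theory.
Local Open Scope classical_set_scope.
Local Open Scope ring_scope.

Definition config := int -> bool.

Definition path_encoding (eta : config) (n : int) : int :=
  match n with
  | Posz k => \sum_(1 <= i < k.+1) (1 - 2 * (eta i%:Z)%:R)
  | Negz k => - \sum_(0 <= i < k.+1) (1 - 2 * (eta (- i%:Z))%:R)
  end.

Lemma path_encoding0 eta : path_encoding eta 0 = 0.
Proof. by rewrite /= big_geq. Qed.

Lemma path_encodingB eta n :
  path_encoding eta n - path_encoding eta (n - 1) = 1 - 2 * (eta n)%:R.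
Proof.
case: n => [[|n]|n].
- by rewrite /= big_geq // big_nat1 oppr0 sub0r opprK.
- have -> : Posz n.+1 - 1 = Posz n by rewrite -addn1 PoszD addrK.
  rewrite /path_encoding [X in X - _]big_nat_recr //=.
  by rewrite addrAC subrr add0r.
- have -> : Negz n - 1 = Negz n.+1 by rewrite !NegzE -opprD -PoszD addn1.
  rewrite /path_encoding [X in _ - - X]big_nat_recr //=.
  by rewrite opprK addKr NegzE.
Qed.

(* The supremum is taken in the integers; it has the junk value 0 when the
   path is unbounded above on (-oo, n], i.e. when M_n is infinite. *)
Definition past_max (S : int -> int) (n : int) : int :=
  supremum 0 [set S m | m in [set m : int | m <= n]].

Definition carrier (eta : config) (n : int) : int :=
  past_max (path_encoding eta) n - path_encoding eta n.

Definition pitman (S : int -> int) (n : int) : int :=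
  2 * past_max S n - S n - 2 * past_max S 0.

Definition box_ball (eta : config) : config := fun n =>
  pitman (path_encoding eta) n - pitman (path_encoding eta) (n - 1) == -1.

Definition reverse_config (eta : config) : config := fun n => eta (- (n - 1)).

Definition reverse_carrier (W : int -> int) : int -> int := fun n => W (- n).

(* Strings are indexed from 1, so entry x n = x_n for 1 <= n <= size x, and
   entry x 0 is the last entry of x. *)
Definition entry (x : seq bool) (n : nat) : bool :=
  nth false x (if n is n'.+1 then n' else (size x).-1).

Definition pair10 (x : seq bool) (n : nat) : bool :=
  entry x n.-1 && ~~ entry x n.

Definition f1 (x : seq bool) : nat :=
  (\sum_(1 <= n < (size x).+1) pair10 x n)%N.

(* The entry x_n is deleted when it is the 0 of the pair (x_{n-1}, x_n) or the
   1 of the pair (x_n, x_{n+1}), where x_{m+1} := x_1 for m = size x. *)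
Definition remove10 (x : seq bool) : seq bool :=
  [seq entry x n | n <- iota 1 (size x)
    & ~~ pair10 x n && ~~ pair10 x (if n == size x then 1 else n.+1)%N].

Definition conserved (k : nat) (x : seq bool) : nat :=
  if k is k'.+1 then f1 (iter k' remove10 x)
  else (\sum_(1 <= n < (size x).+1) entry x n)%N.

(* If no beta k is -oo, the exponent is never +oo, so fine loses nothing. *)
Definition gibbs_weight (R : realType) (beta : nat -> \bar R) (N : nat)
    (x : N.-tuple bool) : R :=
  fine (expeR (- \sum_(0 <= k <oo) (beta k * (conserved k x)%:R%:E))%E)
  * ((conserved 0 x)%:R < N%:R / 2 :> R)%:R.

Definition gibbs_Z (R : realType) (beta : nat -> \bar R) (N : nat) : R :=
  \sum_(x : N.-tuple bool) gibbs_weight beta x.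

Definition periodic_extension (N : nat) (x : N.-tuple bool) : config :=
  fun n => nth false x `|((n - 1) %% N%:Z)%Z|%N.

Definition cylinders (E : Type) : set (set (int -> E)) :=
  [set A | exists (n : int) (B : set E), A = [set w | B (w n)]].

(* Equality in law of two E-valued processes indexed by the integers, for E
   countable with its discrete sigma-algebra; the first two clauses say that X
   and Y are random elements of the product space. *)
Definition eq_in_law (R : realType) (d : measure_display)
    (Omega : measurableType d) (P : probability Omega R) (E : Type)
    (X Y : Omega -> int -> E) : Prop :=
  [/\ forall A, <<s @cylinders E >> A -> measurable (X @^-1` A),
      forall A, <<s @cylinders E >> A -> measurable (Y @^-1` A) &
      forall A, <<s @cylinders E >> A -> P (X @^-1` A) = P (Y @^-1` A)].

(* Main.v *)
Require Import Defs.
From HB Require Import structures.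
From mathcomp Require Import all_boot all_order all_algebra.
From mathcomp Require Import all_classical all_reals all_analysis.
From mathcomp Require Import zify.
Import Order.TTheory GRing.Theory Num.Theory.
Local Open Scope classical_set_scope.
Local Open Scope ring_scope.

(* A carrier of an N-periodic configuration x is an N-periodic solution of
   w_n = w_{n-1} + 1 if x_n = 1, w_n = max(w_{n-1} - 1, 0) if x_n = 0; it is
   unique when the 0s outnumber the 1s, M - S is one, and (T x)_n = 1 iff x_n = 0
   and w_{n-1} > 0. Read backwards, the carrier of x solves the same recursion for
   the reversal of T x, so rev W(x) = W(rev (T x)); as a carrier determines its
   configuration, T is injective.

   Conservation of f_k: the factors 10 of x sit exactly where T x has factors 01,
   and deleting both commutes with T. Deleting the 10s or the 01s of a cyclic
   word yields, up to rotation, the word with one letter for each pair of equal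
   neighbours. Hence H (T x) is a rotation of T (H x), and likewise H (rev x) is a
   rotation of rev (H x). Since f_1 is invariant under rotation and reversal and
   counts the same number of 01s in T x as of 10s in x, all f_k are invariant
   under T and reversal. So x |-> rev x, x |-> rev (T x) and T are bijections
   that preserve the law. *)

(** * Cyclic words *)

Section Words.
Local Open Scope nat_scope.
Implicit Types (a p q nx : bool) (s x y : seq bool) (w : nat).

(* Here p is the letter before s and nx the letter after it, and the deleted
   factors are a ~~a: the box-ball deletion H of 10 is the case a = true. *)
Fixpoint delete_pairs a p s nx : seq bool :=
  if s is c :: s' then
    if (if c == a then head nx s' else p) == c
    then c :: delete_pairs a c s' nx else delete_pairs a c s' nx
  else [::].

Definition cyc_delete a x := delete_pairs a (last false x) x (head false x).

Fixpoint repeats p s : seq bool :=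
  if s is c :: s' then
    if p == c then c :: repeats c s' else repeats c s'
  else [::].

Definition cyc_repeats x := repeats (last false x) x.

Fixpoint count_pairs a p s : nat :=
  if s is c :: s' then ((p == a) && (c != a)) + count_pairs a c s' else 0.

Definition cyc_count a x := count_pairs a (last false x) x.

(** * Rotations of cyclic words *)

Definition rotation x y := exists n, y = rot n x.

Lemma rotation_refl x : rotation x x.
Proof. by exists 0; rewrite rot0. Qed.

Lemma rotation_sym x y : rotation x y -> rotation y x.
Proof.
case=> n ->; case: (leqP n (size x)) => hn.
  by exists (size x - n); rewrite -(size_rot n x) -[RHS]/(rotr n _) rotK.
by exists 0; rewrite rot0 rot_oversize // ltnW.
Qed.

Lemma rotation_catC x y : rotation (x ++ y) (y ++ x).
Proof. by exists (size x); rewrite rot_size_cat. Qed.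

Lemma rotation_trans y x z : rotation x y -> rotation y z -> rotation x z.
Proof.
have rotE n s : exists2 m, m <= size s & rot n s = rot m s.
  case: (leqP n (size s)) => hn; first by exists n.
  by exists 0; rewrite ?rot0 ?rot_oversize ?(ltnW hn).
case=> n -> [m ->]; have [n' hn' ->] := rotE n x.
have [m' hm' ->] := rotE m (rot n' x); rewrite size_rot in hm'.
by rewrite rot_add_mod //; eexists.
Qed.

Lemma rotation_rev x y : rotation x y -> rotation (rev x) (rev y).
Proof.
case=> n ->; rewrite /rot rev_cat -{1}(cat_take_drop n x) rev_cat.
exact: rotation_catC.
Qed.

(** A nontrivial rotation swaps two nonempty blocks; nonemptiness makes [last] independent of its
    default on each block. *)
Lemma rotation_ind (P : seq bool -> seq bool -> Prop) :
  P [::] [::] ->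
  (forall b s c t, P ((b :: s) ++ (c :: t)) ((c :: t) ++ (b :: s))) ->
  (forall s, P s s) -> forall x y, rotation x y -> P x y.
Proof.
move=> P0 PC PI x _ [n ->]; rewrite /rot -{1}(cat_take_drop n x).
by case: (take n x) => [|b s]; case: (drop n x) => [|c t]; rewrite ?cats0.
Qed.

Lemma repeats_cat p s t :
  repeats p (s ++ t) = repeats p s ++ repeats (last p s) t.
Proof. by elim: s p => //= c s IHs p; rewrite IHs; case: ifP. Qed.

Lemma count_pairs_cat a p s t :
  count_pairs a p (s ++ t) = count_pairs a p s + count_pairs a (last p s) t.
Proof. by elim: s p => //= c s IHs p; rewrite IHs addnA. Qed.

Lemma rotation_repeats x y :
  rotation x y -> rotation (cyc_repeats x) (cyc_repeats y).
Proof.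
elim/rotation_ind: x y / => [|b s c t|s]; try exact: rotation_refl.
by rewrite /cyc_repeats !repeats_cat !last_cat; apply: rotation_catC.
Qed.

Lemma rotation_count a x y : rotation x y -> cyc_count a x = cyc_count a y.
Proof.
elim/rotation_ind: x y / => [|b s c t|s] //.
by rewrite /cyc_count !count_pairs_cat !last_cat addnC.
Qed.

(* Both deletions keep one letter for each pair of equal neighbours, at one end
   of the pair or at the other. *)
Lemma delete_pairsE a p s nx :
  nseq ((p == a) && (head nx s == a)) a ++ delete_pairs a p s nx =
  repeats p s ++ nseq ((last p s == a) && (nx == a)) a.
Proof.
elim: s p => [|c s IHs] p /=; first by rewrite cats0.
have := IHs c; case: ifP; case: (eqVneq c a) => [->|ca] /=.
- by move=> /eqP -> ; rewrite eqxx /= => ->; case: eqVneq.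
- by move=> /eqP -> ->; rewrite (negbTE ca) eqxx.
- by move=> -> /= ->; case: eqVneq.
by move=> -> ->; rewrite andbF.
Qed.

(** On a cycle the two boundary terms of [delete_pairsE] coincide: both say that the seam joins two
    letters [a]. That pair is recorded at the end of one word and at the front of the other, so at
    most one letter moves around. *)
Lemma rotation_delete a x : rotation (cyc_delete a x) (cyc_repeats x).
Proof.
case: x => [|b s]; first exact: rotation_refl.
have := delete_pairsE a (last b s) (b :: s) b.
rewrite /cyc_delete /cyc_repeats; set D := delete_pairs _ _ _ _.
set E := repeats _ _; rewrite /=; case: andP => _ /=; last first.
  by rewrite cats0 => ->; apply: rotation_refl.
case: E => [|e E] /= [] => [->|<- ->]; first exact: rotation_refl.
by rewrite cats1 -rot1_cons; apply: rotation_sym; exists 1.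
Qed.

Lemma last_rev_belast c s : last (last c s) (rev (belast c s)) = c.
Proof. by case: s => //= d s; rewrite rev_cons last_rcons. Qed.

(** Read backwards, [p :: s] starts with [last p s] and goes on with [rev (belast p s)]; equality of
    neighbours is symmetric, and either of the two may be kept. *)
Lemma repeats_rev p s :
  rev (repeats p s) = repeats (last p s) (rev (belast p s)).
Proof.
elim: s p => //= c s IHs p; rewrite rev_cons -cats1 repeats_cat -IHs.
rewrite last_rev_belast.
by rewrite /= eq_sym; case: eqVneq => [->|_]; rewrite ?cats0 // rev_cons cats1.
Qed.

Lemma count_pairs_rev a p s :
  count_pairs a p s = count_pairs (~~ a) (last p s) (rev (belast p s)).
Proof.
elim: s p => //= c s IHs p; rewrite rev_cons -cats1 count_pairs_cat -IHs.
rewrite last_rev_belast.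
by rewrite /= addn0 addnC {IHs}; congr (_ + _); case: a p c => [] [] [].
Qed.

Lemma last_last x : last (last false x) x = last false x.
Proof. by case: x. Qed.

(** The letter at the seam changes sides under reversal, which costs one rotation. *)
Lemma rev_belast_last x : rev (belast (last false x) x) = rot 1 (rev x).
Proof.
case: x => //= b s.
rewrite -[LHS]/(rev (last b s :: belast b s)).
by rewrite rev_cons lastI rev_rcons rot1_cons.
Qed.

Lemma last_rot1_rev x : last false (rot 1 (rev x)) = last false x.
Proof.
by rewrite -rev_belast_last; case: x => //= b s; rewrite rev_cons last_rcons.
Qed.

Lemma rotation_repeats_rev x :
  rotation (cyc_repeats (rev x)) (rev (cyc_repeats x)).
Proof.
have -> : rev (cyc_repeats x) = cyc_repeats (rot 1 (rev x)).
  by rewrite /cyc_repeats repeats_rev rev_belast_last last_rot1_rev last_last.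
by apply: rotation_repeats; exists 1.
Qed.

Lemma cyc_count_rev a x : cyc_count a (rev x) = cyc_count (~~ a) x.
Proof.
have -> : cyc_count (~~ a) x = cyc_count a (rot 1 (rev x)).
  rewrite /cyc_count count_pairs_rev negbK rev_belast_last.
  by rewrite last_rot1_rev last_last.
by apply: rotation_count; exists 1.
Qed.

(** Factors 10 and 01 alternate, so the difference of their numbers depends only on the end letters
    and vanishes on a cycle. *)
Lemma count_pairs_flip p s :
  count_pairs true p s + last p s = count_pairs false p s + p.
Proof.
elim: s p => [|c s IHs] p //=; move: (IHs c).
by case: p c => [] [] /=; lia.
Qed.

Lemma cyc_count_flip a x : cyc_count a x = cyc_count (~~ a) x.
Proof.
have h : cyc_count true x = cyc_count false x.
  case: x => [|b s] //; apply/eqP; rewrite -(eqn_add2r (last b s)).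
  by rewrite [X in X == _](count_pairs_flip _ (b :: s)).
by case: a.
Qed.

Lemma rotation_delete_congr a b x y :
  rotation x y -> rotation (cyc_delete a x) (cyc_delete b y).
Proof.
move=> xy; apply: rotation_trans (rotation_delete a x) _.
apply: rotation_trans (rotation_repeats _ _ xy) _.
exact/rotation_sym/rotation_delete.
Qed.

Lemma rotation_delete_rev x y : rotation x (rev y) ->
  rotation (cyc_delete true x) (rev (cyc_delete true y)).
Proof.
move=> xy; apply: rotation_trans (rotation_delete_congr true true _ _ xy) _.
apply: rotation_trans (rotation_delete _ _) _.
apply: rotation_trans (rotation_repeats_rev _) _.
by apply: rotation_rev; apply/rotation_sym/rotation_delete.
Qed.

(** * The carrier and the box-ball map on finite words *)

Definition carrier_step w c := if c then w.+1 else w.-1.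

Definition carry := foldl carrier_step.

Fixpoint ball_out w s : seq bool :=
  if s is c :: s' then (~~ c && (0 < w)) :: ball_out (carrier_step w c) s'
  else [::].

Lemma size_ball_out w s : size (ball_out w s) = size s.
Proof. by elim: s w => //= c s IHs w; rewrite IHs. Qed.

Lemma nth_ball_out w s i : i < size s ->
  nth false (ball_out w s) i = ~~ nth false s i && (0 < carry w (take i s)).
Proof. by elim: s w i => [|c s IHs] w [|i] //= hi; rewrite IHs. Qed.

Lemma carry_count w s :
  carry w s + count id (ball_out w s) = w + count id s.
Proof.
elim: s w => [|c s IHs] w //=; rewrite addnCA IHs.
by case: c; case: w => //= w; lia.
Qed.

(* A carrier w preceded by the letter p of the configuration and by the letter q
   of its image. *)
Definition carrier_compat p q w := if 0 < w then q == ~~ p else ~~ p.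

Lemma carrier_compat_step p q w c : carrier_compat p q w ->
  carrier_compat c (~~ c && (0 < w)) (carrier_step w c).
Proof. by case: c p q w => [] [] [] [|[]]. Qed.

Lemma carrier_compat_last p q w s : carrier_compat p q w ->
  carrier_compat (last p s) (last q (ball_out w s)) (carry w s).
Proof.
by elim: s p q w => //= c s IHs p q w h; apply/IHs/carrier_compat_step/h.
Qed.

(** Under a loaded carrier the image is the complement of the word at both letters of the pair.
    Under an empty one [p] and the next output are 0, and neither side has a pair. *)
Lemma count_pairs_ball_out p q w s : carrier_compat p q w ->
  count_pairs false q (ball_out w s) = count_pairs true p s.
Proof.
elim: s p q w => //= c s IHs p q w h.
rewrite (IHs c) ?(carrier_compat_step p q) //.
by congr (_ + _); case: p q c w h => [] [] [] [].
Qed.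

(* A 1 that is about to be deleted has not been loaded by the reduced carrier. *)
Lemma ball_out_delete p q w s nx : carrier_compat p q w ->
  let w' := w - (p && ~~ head nx s) in
  ball_out w' (delete_pairs true p s nx) =
    delete_pairs false q (ball_out w s) (~~ nx && (0 < carry w s)) /\
  carry w' (delete_pairs true p s nx) = carry w s - (last p s && ~~ nx).
Proof.
elim: s p q w => [|c s IHs] p q w h //=.
have := IHs _ _ _ (carrier_compat_step p q w c h).
have -> : head (~~ nx && (0 < carry (carrier_step w c) s))
    (ball_out (carrier_step w c) s) = ~~ head nx s && (0 < carrier_step w c).
  by case: s {IHs}.
by case: (head nx s); case: p q c w h {IHs} => [] [] [] [|w] //= _ [];
  rewrite ?subn0 ?subSS ?subn0 /= => -> ->.
Qed.

(** A load restored after one reading of [x] belongs to a periodic carrier, and [y] is one period of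
    its output. *)
Definition ball_image x y := exists2 w, carry w x = w & y = ball_out w x.

Lemma ball_image_compat w x : carry w x = w ->
  carrier_compat (last false x) (last true (ball_out w x)) w.
Proof.
(* The letters 0 and 1 are compatible with every load; one full turn from them ends with the load
   [w] and the last letters of word and image. *)
move=> e; rewrite -[in X in carrier_compat _ _ X]e; apply: carrier_compat_last.
by rewrite /carrier_compat; case: ifP.
Qed.

Lemma ball_image_count x y :
  ball_image x y -> cyc_count true x = cyc_count false y.
Proof.
case=> w + ->; case: x => // b s e.
have h := ball_image_compat _ _ e.
by rewrite /cyc_count -(count_pairs_ball_out _ _ _ (b :: s) h).
Qed.

Lemma ball_image_delete x y : ball_image x y ->
  ball_image (cyc_delete true x) (cyc_delete false y).
Proof.
case=> w + ->; case: x => [|b s] e; first by exists w.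
have [h1 h2]  := ball_out_delete _ _ _ (b :: s) b (ball_image_compat _ _ e).
rewrite e in h1 h2.
by exists (w - (last false (b :: s) && ~~ b)); [exact: h2 | exact: esym h1].
Qed.

(** The image of the reduced word is [y] without its 01s, whereas f_k removes 10s. The word [z]
    follows the latter deletion and stays a rotation of the former. *)
Lemma iter_delete_image k x y z : ball_image x y -> rotation y z ->
  cyc_count true (iter k (cyc_delete true) x) =
  cyc_count true (iter k (cyc_delete true) z).
Proof.
elim: k x y z => [|k IHk] x y z xy yz /=.
  by rewrite (ball_image_count _ _ xy) cyc_count_flip (rotation_count _ _ _ yz).
rewrite -!iterS !iterSr; apply: (IHk _ _ _ (ball_image_delete _ _ xy)).
exact: rotation_delete_congr.
Qed.

Lemma iter_delete_rev k x y : rotation x (rev y) ->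
  cyc_count true (iter k (cyc_delete true) x) =
  cyc_count true (iter k (cyc_delete true) y).
Proof.
elim: k x y => [|k IHk] x y xy /=.
  by rewrite (rotation_count _ _ _ xy) cyc_count_rev -cyc_count_flip.
by rewrite -!iterS !iterSr; apply/IHk/rotation_delete_rev.
Qed.

Lemma ball_image_size x y : ball_image x y -> count id y = count id x.
Proof.
by case=> w e ->; have := carry_count w x; rewrite e => /addnI.
Qed.

Lemma carry_cat w s t : carry w (s ++ t) = carry (carry w s) t.
Proof. exact: foldl_cat. Qed.

(* Two carriers that never meet both keep unloading at each 0, which a
   stationary carrier cannot do when the 0s outnumber the 1s. *)
Lemma carry_contract u w s : u < w ->
  carry u s <= carry w s /\ (carry w s + u < carry u s + w \/
  carry w s + count negb s = w + count id s).
Proof.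
elim/last_ind: s => [|t c IHt] uw /=; first by split; [exact: ltnW | right].
rewrite -cats1 !carry_cat !count_cat /=; move: (IHt uw).
by case: c; rewrite /carrier_step /=; lia.
Qed.

Lemma stationary_carry_unique u w s : count id s < count negb s ->
  carry u s = u -> carry w s = w -> u = w.
Proof.
move=> hs eu ew.
by case: (ltngtP u w) => // /(carry_contract _ _ s); rewrite eu ew; lia.
Qed.

(** * The functions f_k as cyclic counts *)

Lemma entry_size (s t : seq bool) :
  entry (s ++ t) (size s) = last (last false (s ++ t)) s.
Proof.
(* For empty [s] the index is 0, where [entry] returns the last letter of the word. *)
case/lastP: s => [|s c]; first by rewrite /entry /= nth_last.
rewrite size_rcons last_rcons /entry nth_cat size_rcons ltnSn.
by rewrite nth_rcons ltnn eqxx.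
Qed.

Lemma entry_sizeS (s t : seq bool) c : entry (s ++ c :: t) (size s).+1 = c.
Proof. by rewrite /entry nth_cat ltnn subnn. Qed.

Lemma pair10_size (s t : seq bool) c :
  pair10 (s ++ c :: t) (size s).+1 =
  last (last false (s ++ c :: t)) s && ~~ c.
Proof. by rewrite /pair10 entry_sizeS -entry_size. Qed.

Lemma pair10_next (s t : seq bool) c (x := s ++ c :: t) :
  pair10 x (if (size s).+1 == size x then 1 else (size s).+2) =
  c && ~~ head (head false x) t.
Proof.
rewrite /x; case: t {x} => [|d t].
  rewrite size_cat addn1 eqxx /pair10 [1.-1]/= /entry size_cat addn1.
  rewrite nth_cat ltnn subnn.
  by congr (_ && ~~ _); case: s.
have -> : ((size s).+1 == size (s ++ c :: d :: t)) = false.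
  by rewrite size_cat /=; lia.
by rewrite -cat_rcons -(size_rcons s c) pair10_size last_rcons.
Qed.

Lemma f1E x : f1 x = cyc_count true x.
Proof.
rewrite /f1 /index_iota subn1 /cyc_count.
(* The induction is on the tail with [x] fixed, because the letter closing the cycle is that of the
   whole word. *)
suff H (s t : seq bool) : x = s ++ t ->
    \sum_(n <- iota (size s).+1 (size t)) pair10 x n =
    count_pairs true (last (last false x) s) t by exact: (H [::]).
elim: t s => [|c t IHt] s ex /=; first by rewrite big_nil.
rewrite big_cons {1}ex pair10_size -ex; congr (_ + _).
  by case: (last _ s) c {ex} => [] [].
by rewrite -(size_rcons s c) IHt ?last_rcons // cat_rcons.
Qed.

Lemma remove10E x : remove10 x = cyc_delete true x.
Proof.
rewrite /remove10 /cyc_delete; set P := (fun n => _ && _).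
suff H (s t : seq bool) : x = s ++ t ->
    [seq entry x n | n <- iota (size s).+1 (size t) & P n] =
    delete_pairs true (last (last false x) s) t (head false x).
  exact: (H [::]).
elim: t s => [|c t IHt] s ex //=.
have -> : P (size s).+1 =
    ((if c == true then head (head false x) t else last (last false x) s) == c).
  rewrite /P {1 2 3}ex pair10_size pair10_next -ex {P IHt ex}.
  by case: c (last _ s) (head _ t) => [] [] [].
have {}IHt := IHt (rcons s c); rewrite size_rcons last_rcons cat_rcons in IHt.
by case: ifP => _ /=; rewrite IHt // {1}ex entry_sizeS.
Qed.

Lemma conservedS k x :
  conserved k.+1 x = cyc_count true (iter k (cyc_delete true) x).
Proof.
by rewrite /= f1E; congr cyc_count; elim: k => //= k ->; rewrite remove10E.
Qed.

Lemma conserved0 x : conserved 0 x = count id x.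
Proof.
rewrite /= big_add1 /= big_mkord -sum1_count [RHS]big_mkcond.
rewrite (big_nth false) big_mkord; apply: eq_bigr => i _.
by rewrite /entry /=; case: (nth false x i).
Qed.

Lemma conserved_rev k x : conserved k (rev x) = conserved k x.
Proof.
case: k => [|k]; first by rewrite !conserved0 count_rev.
by rewrite !conservedS; apply/iter_delete_rev/rotation_refl.
Qed.

Lemma conserved_ball k x y : ball_image x y -> conserved k y = conserved k x.
Proof.
move=> xy; case: k => [|k].
  by rewrite !conserved0 (ball_image_size _ _ xy).
by rewrite !conservedS (iter_delete_image _ _ _ _ xy (rotation_refl _)).
Qed.
End Words.

(** * The carrier process *)

Section Carrier.
Implicit Types (S : int -> int) (eta : config).

Definition is_past_max S n M :=
  (exists2 m, (m <= n)%R & S m = M) /\ (forall m, (m <= n)%R -> (S m <= M)%R).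

Lemma is_past_max_eq S n M : is_past_max S n M -> past_max S n = M.
Proof.
case=> [[m mn Sm]] ub; rewrite /past_max /supremum ifF; last first.
  by apply/eqP => /seteqP[/(_ M) + _]; apply; exists m.
set A := [set _ | _ in _]; have supM : supremums A M.
  split=> [_ [k kn <-]|b]; first exact: ub.
  by apply; exists m.
by case: xgetP => [c _ supc|/(_ M)] //; exact: is_subset1_supremums supc supM.
Qed.

(** Gaps [B - S m] are natural numbers, so a least one exists and the supremum is attained there. *)
Lemma past_maxP S n B : (forall m, m <= n -> S m <= B) ->
  is_past_max S n (past_max S n).
Proof.
move=> ub.
have ex : exists k : nat, `[< exists2 m, m <= n & S m = B - k%:Z >].
  exists `|B - S n|%N; apply/asboolP; exists n => //.
  have := ub n (lexx _); lia.
case: (ex_minnP ex) => k /asboolP[m mn Sm] kmin.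
suff h : is_past_max S n (B - k%:Z) by rewrite (is_past_max_eq _ _ _ h).
split; first by exists m.
move=> l ln; have := ub l ln => lB.
have /kmin : `[< exists2 m, m <= n & S m = B - `|B - S l|%N%:Z >].
  by apply/asboolP; exists l => //; lia.
lia.
Qed.

Lemma path_encoding_step eta n :
  path_encoding eta n = path_encoding eta (n - 1) + (1 - 2 * (eta n)%:R).
Proof. by rewrite -path_encodingB addrC subrK. Qed.

(** Finiteness of every M_n, which keeps [past_max] off its default value. *)
Definition bounded_past eta :=
  forall n, exists B, forall m, m <= n -> path_encoding eta m <= B.

Lemma past_max_step eta n : bounded_past eta ->
  past_max (path_encoding eta) n =
  Num.max (past_max (path_encoding eta) (n - 1)) (path_encoding eta n).
Proof.
move=> bd; have [B /past_maxP [[m mn <-]] ub] := bd (n - 1).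
apply: is_past_max_eq; split.
  by case: leP => _; [exists n | exists m => //; lia].
move=> k kn; rewrite le_max; have [->|kn'] := eqVneq k n.
  by rewrite lexx orbT.
by rewrite ub //; lia.
Qed.

Lemma carrier_ge0 eta n : bounded_past eta -> 0 <= carrier eta n.
Proof. by move=> bd; rewrite subr_ge0 past_max_step // le_max lexx orbT. Qed.

Lemma carrier_rec eta n : bounded_past eta ->
  carrier eta n = if eta n then carrier eta (n - 1) + 1
                  else Num.max (carrier eta (n - 1) - 1) 0.
Proof.
move=> bd; have := carrier_ge0 _ (n - 1) bd.
rewrite /carrier (past_max_step _ n) // (path_encoding_step _ n).
by case: (eta n) => /=; lia.
Qed.

(** The increment of TS is twice that of M minus that of S; it is -1 exactly when S steps up without
    raising M. *)
Lemma box_ballE eta n : bounded_past eta ->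
  box_ball eta n = ~~ eta n && (0 < carrier eta (n - 1)).
Proof.
move=> bd; have := carrier_ge0 _ (n - 1) bd.
rewrite /box_ball /pitman /carrier (past_max_step _ n) //.
rewrite (path_encoding_step _ n).
case: (eta n) => /=; lia.
Qed.

(** The carrier rises at each 1 and never at a 0. *)
Lemma carrier_inj eta eta' : bounded_past eta -> bounded_past eta' ->
  carrier eta = carrier eta' -> eta = eta'.
Proof.
move=> bd bd' e; apply/funext => n.
have := carrier_rec _ n bd; have := carrier_rec _ n bd'.
have := carrier_ge0 _ (n - 1) bd; rewrite e.
by case: (eta n) (eta' n) => [] [] //; lia.
Qed.
End Carrier.

(** * Periodic configurations *)

Section Periodic.
Variables (N : nat) (hN : (0 < N)%N).
Implicit Types x y : N.-tuple bool.

Definition periodic {T : Type} (f : int -> T) := forall n, f (n + N%:Z) = f n.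

Lemma periodic_mulz {T} (f : int -> T) n (q : int) :
  periodic f -> f (n + q * N%:Z) = f n.
Proof.
move=> per; have perM k m : f (m + k%:Z * N%:Z) = f m.
  elim: k m => [|k IHk] m; first by rewrite mul0r addr0.
  by rewrite -addn1 PoszD mulrDl mul1r addrA per IHk.
case: q => k; first exact: perM.
by rewrite -[LHS](perM k.+1) -addrA -mulrDl NegzE addNr mul0r addr0.
Qed.

Lemma periodic_ext {T} (f g : int -> T) : periodic f -> periodic g ->
  (forall i, (i < N)%N -> f i.+1%:Z = g i.+1%:Z) -> f =1 g.
Proof.
move=> pf pg fg n; have [r [q [rN ->]]] :
    exists r, exists q, (r < N)%N /\ n = r.+1%:Z + q * N%:Z.
  exists `|((n - 1) %% N%:Z)%Z|%N, ((n - 1) %/ N%:Z)%Z.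
  have N0 : N%:Z != 0 by lia.
  have := modz_ge0 (n - 1) N0; have := ltz_pmod (n - 1) (d := N%:Z).
  have := divz_eq (n - 1) N%:Z; lia.
by rewrite !periodic_mulz // fg.
Qed.

Lemma periodic_extension_periodic x : periodic (periodic_extension x).
Proof.
by move=> n; rewrite /periodic_extension addrAC modzDr.
Qed.

Lemma periodic_extensionS x i : (i < N)%N ->
  periodic_extension x i.+1 = nth false x i.
Proof.
move=> iN; rewrite /periodic_extension -addn1 PoszD addrK.
by rewrite modz_small //; lia.
Qed.

Lemma reverse_periodic x :
  reverse_config (periodic_extension x) = periodic_extension (rev_tuple x).
Proof.
apply/funext/periodic_ext => [n||i iN].
- rewrite /reverse_config -[LHS](periodic_extension_periodic).
  by congr periodic_extension; lia.
- exact: periodic_extension_periodic.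
rewrite periodic_extensionS // nth_rev ?size_tuple //.
rewrite -periodic_extensionS; last lia.
(* Adding a period moves the index [-i] to [N - i], back among 1, ..., N. *)
rewrite /reverse_config -[LHS](periodic_extension_periodic).
by congr periodic_extension; lia.
Qed.

Definition sparse x := (count id x * 2 < N)%N.

Lemma path_encoding_period x n :
  path_encoding (periodic_extension x) (n + N%:Z) =
  path_encoding (periodic_extension x) n + (N%:Z - (count id x)%:Z * 2).
Proof.
set eta := periodic_extension x; set S := path_encoding eta.
have SN : S N%:Z = N%:Z - (count id x)%:Z * 2.
  rewrite /S /path_encoding big_add1 /= big_mkord.
  rewrite (eq_bigr (fun i : 'I_N => 1 - 2 * (nth false x i)%:R)); last first.
    by move=> i _; rewrite /eta periodic_extensionS.
  rewrite big_split /= sumr_const card_ord sumrN -mulr_sumr mulrC.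
  congr (_ - _ * _); first exact: natz.
  rewrite -sum1_count (big_nth false) big_mkord size_tuple -natr_sum natz.
  congr Posz; rewrite [RHS]big_mkcond.
  by apply: eq_bigr => i _ /=; case: (nth _ _ _).
(* The gain over N steps does not depend on where they start, so it equals [S N] everywhere. *)
have step k : S (k + N%:Z) - S k = S (k - 1 + N%:Z) - S (k - 1).
  rewrite /S (path_encoding_step _ (k + _)) (path_encoding_step _ k).
  rewrite /eta periodic_extension_periodic [k + _ - 1]addrAC.
  by rewrite opprD addrACA subrr addr0.
have S0 : S 0 = 0 by exact: path_encoding0.
rewrite -SN; move: S {SN} step S0 => S step S0.
case: n => n; elim: n => [|n IHn].
- by rewrite add0r S0 add0r.
- have := step n.+1%:Z; have -> : n.+1%:Z - 1 = n%:Z by lia.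
  by lia.
- have := step 0; have -> : 0 - 1 = Negz 0 by [].
  by rewrite add0r; lia.
have := step (Negz n); have -> : Negz n - 1 = Negz n.+1 by lia.
by lia.
Qed.

Lemma path_encoding_lip eta n (k : nat) :
  path_encoding eta (n - k%:Z) <= path_encoding eta n + k%:Z.
Proof.
elim: k => [|k]; first by rewrite subr0; lia.
rewrite (path_encoding_step _ (n - k%:Z)).
have -> : n - k%:Z - 1 = n - k.+1%:Z by lia.
by case: (eta _) => /=; lia.
Qed.

(** The drift per period is positive, so going back a period lowers the path; only the last N
    positions before [n] matter, and there the path exceeds its value at [n] by at most N. *)
Lemma sparse_bounded_past x : sparse x -> bounded_past (periodic_extension x).
Proof.
rewrite /sparse => hx n.
exists (path_encoding (periodic_extension x) n + N%:Z) => m mn.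
have [k ->] : exists k : nat, m = n - k%:Z by exists `|n - m|%N; lia.
elim/ltn_ind: k {mn m} => k IHk; have [kN|Nk] := ltnP k N.
  by apply: le_trans (path_encoding_lip _ _ _) _; rewrite lerD2l lez_nat ltnW.
apply: le_trans (IHk (k - N)%N _); last lia.
have -> : n - (k - N)%N%:Z = n - k%:Z + N%:Z by lia.
by rewrite path_encoding_period lerDl; lia.
Qed.

(** Over a period M gains the same drift as S. *)
Lemma carrier_periodic x : sparse x -> periodic (carrier (periodic_extension x)).
Proof.
move=> hx n; rewrite /carrier path_encoding_period.
have [B /past_maxP [[m mn Sm] ub]] := sparse_bounded_past x hx n.
set M := past_max _ n; set c := N%:Z - _.
rewrite (is_past_max_eq _ (n + _) (M + c)); first lia.
split; first by exists (m + N%:Z); [lia | rewrite path_encoding_period Sm].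
move=> k kn; rewrite -[k](subrK N%:Z) path_encoding_period lerD2r ub //; lia.
Qed.

(** * Periodic carriers, their uniqueness and their reversal *)

Definition is_carrier (eta : config) (U : int -> nat) :=
  forall n, U n = carrier_step (U (n - 1)) (eta n).

Lemma carry_is_carrier x U i : is_carrier (periodic_extension x) U ->
  (i <= N)%N -> carry (U 0) (take i x) = U i.
Proof.
move=> hU; elim: i => [|i IHi] iN; first by rewrite take0.
rewrite (take_nth false) ?size_tuple // -cats1 carry_cat IHi ?(ltnW iN) //=.
rewrite [RHS]hU periodic_extensionS //.
by have -> : i.+1%:Z - 1 = i%:Z by lia.
Qed.

(** Both loads at 0 are restored by reading one period, hence agree by [stationary_carry_unique];
    the recursion does the rest. *)
Lemma is_carrier_unique x U V : sparse x ->
  is_carrier (periodic_extension x) U -> periodic U ->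
  is_carrier (periodic_extension x) V -> periodic V -> U =1 V.
Proof.
move=> hx hU pU hV pV; have fixN (X : int -> nat) :
    is_carrier (periodic_extension x) X -> periodic X -> carry (X 0) x = X 0.
  move=> hX pX; rewrite -[RHS]pX add0r -(carry_is_carrier x X N) //.
  by rewrite -[N in take N _](size_tuple x) take_size.
have UV0 : U 0 = V 0.
  apply: (stationary_carry_unique _ _ x); rewrite ?fixN //.
  have : (count id x + count negb x)%N = N.
    by rewrite -[RHS](size_tuple x) -(count_predC id).
  by move: hx; rewrite /sparse; lia.
apply: periodic_ext => // i iN.
by rewrite -(carry_is_carrier x U) // -(carry_is_carrier x V) // UV0.
Qed.

Lemma carrier_is_carrier eta : bounded_past eta ->
  is_carrier eta (fun n => `|carrier eta n|%N).
Proof.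
move=> bd n; rewrite carrier_rec //; have := carrier_ge0 _ (n - 1) bd.
by rewrite /carrier_step; case: (eta n); lia.
Qed.

Lemma ball_out_tupleP w x : size (ball_out w x) == N.
Proof. by rewrite size_ball_out size_tuple. Qed.
Canonical ball_out_tuple w x := Tuple (ball_out_tupleP w x).

(** Words that are not sparse have weight 0; the identity there lets the map permute all words. *)
Definition ball_tuple x : N.-tuple bool :=
  if sparse x then [tuple of ball_out `|carrier (periodic_extension x) 0|%N x]
  else x.

Lemma ball_tuple_image x : sparse x -> ball_image x (ball_tuple x).
Proof.
move=> hx; rewrite /ball_tuple hx; have bd := sparse_bounded_past _ hx.
eexists; last by [].
have := carry_is_carrier _ _ N (carrier_is_carrier _ bd) (leqnn N).
rewrite -[N in take N _](size_tuple x) take_size => ->.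
by rewrite -[N%:Z]add0r carrier_periodic.
Qed.

Lemma sparse_ball_tuple x : sparse (ball_tuple x) = sparse x.
Proof.
case: (boolP (sparse x)) => hx.
  by rewrite /sparse (ball_image_size _ _ (ball_tuple_image _ hx)).
by rewrite /ball_tuple (negbTE hx) (negbTE hx).
Qed.

Lemma sparse_rev_tuple x : sparse (rev_tuple x) = sparse x.
Proof. by rewrite /sparse count_rev. Qed.

Lemma conserved_ball_tuple k x : conserved k (ball_tuple x) = conserved k x.
Proof.
case: (boolP (sparse x)) => hx; first exact/conserved_ball/ball_tuple_image.
by rewrite /ball_tuple (negbTE hx).
Qed.

Lemma box_ball_periodic x : sparse x ->
  box_ball (periodic_extension x) = periodic_extension (ball_tuple x).
Proof.
move=> hx; have bd := sparse_bounded_past _ hx; apply/funext/periodic_ext.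
- move=> n; rewrite !box_ballE // periodic_extension_periodic.
  by rewrite addrAC carrier_periodic.
- exact: periodic_extension_periodic.
move=> i iN; rewrite box_ballE // !periodic_extensionS //.
rewrite /ball_tuple hx nth_ball_out ?size_tuple //.
rewrite (carry_is_carrier _ _ _ (carrier_is_carrier _ bd)) ?(ltnW iN) //.
rewrite -addn1 PoszD addrK; have := carrier_ge0 _ i%:Z bd.
by case: (nth _ _ _) => //=; lia.
Qed.

Lemma reverse_carrier_periodic x : sparse x ->
  reverse_carrier (carrier (periodic_extension x)) =
  carrier (periodic_extension (rev_tuple (ball_tuple x))).
Proof.
move=> hx; have bd := sparse_bounded_past _ hx.
set y := rev_tuple _.
have hy : sparse y by rewrite sparse_rev_tuple sparse_ball_tuple.
have bdy := sparse_bounded_past _ hy.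
have key : (fun n => `|reverse_carrier (carrier (periodic_extension x)) n|%N) =1
    (fun n => `|carrier (periodic_extension y) n|%N).
  apply: (is_carrier_unique _ _ _ hy).
  (* Going back from [1 - n] to [- n] undoes a carrier step: a ball loaded at a 1 is put down, a
     ball put down where T x has a 1 is taken up, and an empty carrier passing a 0 stays empty. *)
  - move=> n; rewrite -reverse_periodic -box_ball_periodic //.
    rewrite /reverse_carrier /reverse_config box_ballE //.
    have -> : - (n - 1) - 1 = - n by lia.
    rewrite (carrier_rec _ (- (n - 1))) //; have := carrier_ge0 _ (- n) bd.
    have -> : - (n - 1) - 1 = - n by lia.
    rewrite /carrier_step.
    by case: (periodic_extension x (- (n - 1))) => /=; try case: ltP; lia.
  - move=> n; rewrite /reverse_carrier -[in RHS](subrK N%:Z (- n)).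
    by rewrite carrier_periodic // opprD.
  - exact: carrier_is_carrier.
  by move=> n /=; rewrite carrier_periodic.
apply/funext => n; have := key n; rewrite /reverse_carrier.
have := carrier_ge0 _ (- n) bd; have := carrier_ge0 _ n bdy; lia.
Qed.

Lemma ball_tuple_inj : injective ball_tuple.
Proof.
move=> x y e; have hxy : sparse x = sparse y.
  by rewrite -(sparse_ball_tuple x) e sparse_ball_tuple.
case: (boolP (sparse x)) => hx; last first.
  by move: e; rewrite /ball_tuple -hxy (negbTE hx).
have hy : sparse y by rewrite -hxy.
have : carrier (periodic_extension x) = carrier (periodic_extension y).
  (* Reversing twice exhibits the carrier as the reversal of one that depends only on the image
     under T. *)
  have rcK z : carrier z = reverse_carrier (reverse_carrier (carrier z)).
    by apply/funext => n; rewrite /reverse_carrier opprK.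
  rewrite rcK [RHS]rcK (reverse_carrier_periodic x) //.
  by rewrite (reverse_carrier_periodic y) // e.
move/(carrier_inj _ _ (sparse_bounded_past _ hx) (sparse_bounded_past _ hy)) => xy.
apply: val_inj; apply: (@eq_from_nth _ false); rewrite ?size_tuple // => i iN.
by rewrite -(periodic_extensionS x) // xy periodic_extensionS.
Qed.

End Periodic.

(** * Transport of the law *)

Lemma measurable_bool_tuple1 (N : nat) (y : N.-tuple bool) :
  measurable [set y].
Proof.
have -> : [set y] =
    \bigcap_(i in [set: 'I_N]) ((@tnth N bool)^~ i @^-1` [set tnth y i]).
  apply/seteqP; split=> [z -> //|z yz]; apply/eq_from_tnth => i; exact: yz.
apply: fin_bigcap_measurable => // i _.
by rewrite -[X in measurable X]setTI; apply: measurable_tnth.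
Qed.

(** Both laws are sums of [p] over preimages in a finite set. Reindexing by the bijection [phi]
    matches them term by term, since [F] and [G \o phi] differ only where [p] vanishes. *)
Lemma eq_in_law_finite (R : realType) (d : measure_display)
    (Omega : measurableType d) (P : probability Omega R) (T : finType)
    (E : Type)
    (x : Omega -> T) (p : T -> \bar R) (phi : T -> T) (F G : T -> int -> E) :
  (forall y, measurable (x @^-1` [set y])) ->
  (forall y, P (x @^-1` [set y]) = p y) ->
  injective phi -> (forall y, p (phi y) = p y) ->
  (forall y, p y != 0%E -> F y = G (phi y)) ->
  eq_in_law P (F \o x) (G \o x).
Proof.
move=> mx px phi_inj p_phi FG.
have preE (B : set T) : x @^-1` B = \bigcup_(y in B) x @^-1` [set y].
  apply/seteqP; split=> [w Bw|w [y By /= xwy]]; first by exists (x w).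
  by rewrite /preimage /= xwy.
have mpre (B : set T) : measurable (x @^-1` B).
  by rewrite preE; apply: fin_bigcup_measurable.
have PE (B : set T) : P (x @^-1` B) = (\sum_(y \in B) p y)%E.
  rewrite [in LHS]preE measure_fin_bigcup //.
  - by apply: eq_fsbigr => y _; exact: px.
  - exact: finite_finset.
  - by move=> i j _ _ [w [<- <-]].
split=> A _; [exact: (mpre (F @^-1` A)) | exact: (mpre (G @^-1` A)) |].
transitivity (\sum_(y \in F @^-1` A) p y)%E; first exact: PE.
transitivity (\sum_(y \in G @^-1` A) p y)%E; last exact: esym (PE _).
rewrite fsbig_mkcond [RHS]fsbig_mkcond [RHS](reindex_fsbigT phi); last first.
  exact: injF_bij.
apply: eq_fsbigr => y _; rewrite /patch p_phi.
have [->|/FG FGy] := eqVneq (p y) 0%E; first by rewrite !if_same.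
by congr (if _ then _ else _); apply/idP/idP; rewrite !inE /= FGy.
Qed.

Lemma gibbs_weight_conserved (R : realType) (beta : nat -> \bar R) (N : nat)
    (x y : N.-tuple bool) : (forall k, conserved k x = conserved k y) ->
  gibbs_weight beta x = gibbs_weight beta y.
Proof.
move=> xy; rewrite /gibbs_weight xy; congr (fine (expeR (- _)) * _).
by apply: eq_eseriesr => k _; rewrite xy.
Qed.

Lemma gibbs_weight_sparse (R : realType) (beta : nat -> \bar R) (N : nat)
    (x : N.-tuple bool) : gibbs_weight beta x != 0 -> sparse N x.
Proof.
rewrite /gibbs_weight conserved0 /sparse ltr_pdivlMr // -natrM ltr_nat.
by case: ltnP => //; rewrite mulr0 eqxx.
Qed.

Theorem corollary2p9 (R : realType) (N : nat) (hN : (0 < N)%N)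
    (beta : nat -> \bar R) (hbeta : forall k : nat, beta k != -oo%E)
    (d : measure_display) (Omega : measurableType d)
    (P : probability Omega R) (x : {RV P >-> (N.-tuple bool)%type})
    (hlaw : forall y : N.-tuple bool,
      P (x @^-1` [set y]) = ((gibbs_Z beta N)^-1 * gibbs_weight beta y)%:E) :
  let eta : Omega -> config := fun omega => periodic_extension (x omega) in
  let W : Omega -> int -> int := fun omega => carrier (eta omega) in
  [/\ eq_in_law P (fun omega => reverse_config (eta omega)) eta,
      eq_in_law P (fun omega => reverse_carrier (W omega)) W &
      eq_in_law P (fun omega => box_ball (eta omega)) eta].
Proof.
move=> eta W.
have mx y : measurable (x @^-1` [set y]).
  by rewrite -[X in measurable X]setTI; apply: measurable_funPT => //;
    apply: measurable_bool_tuple1.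
(* The weight depends on a word only through the f_k and vanishes off sparse words, so each claim
   reduces to a suitable permutation [phi] of the words. *)
have law E (phi : N.-tuple bool -> N.-tuple bool)
    (F G : N.-tuple bool -> int -> E) :
    injective phi -> (forall k y, conserved k (phi y) = conserved k y) ->
    (forall y, sparse N y -> F y = G (phi y)) -> eq_in_law P (F \o x) (G \o x).
  move=> phi_inj phi_conserved FG.
  apply: (eq_in_law_finite _ _ _ _ _ _ _ _ phi _ _ mx hlaw) => // y.
    by congr (_ * _)%:E; apply: gibbs_weight_conserved => k.
  rewrite eqe mulf_eq0 negb_or => /andP[_ /gibbs_weight_sparse]; exact: FG.
have rev_inj : injective (fun y : N.-tuple bool => rev_tuple y).
  by move=> y z /(congr1 val) /= /(can_inj revK) /val_inj.
split.
- apply: (law _ (fun y => rev_tuple y)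
    (fun y => reverse_config (periodic_extension y))
    (periodic_extension (N:=N))) => // [k y|y _]; first exact: conserved_rev.
  exact: reverse_periodic.
- apply: (law _ (fun y => rev_tuple (ball_tuple N y))
    (fun y => reverse_carrier (carrier (periodic_extension y)))
    (fun y => carrier (periodic_extension y))) => [y z /rev_inj|k y|y].
  + exact: ball_tuple_inj.
  + by rewrite conserved_rev conserved_ball_tuple.
  + exact: reverse_carrier_periodic.
- apply: (law _ (ball_tuple N) (fun y => box_ball (periodic_extension y))
    (periodic_extension (N:=N))) => [|k y|y].
  + exact: ball_tuple_inj.
  + exact: conserved_ball_tuple.
  + exact: box_ball_periodic.
Qed.
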